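(* Let $d\ge 1$, let $X\in\mathbb{R}^d$ and $S\in[0,1]$ be jointly distributed random variables, let $\sigma>0$, and let $X^\sigma = X+\sigma Z$ with $Z\sim\mathcal N(0,I)$ independent of $(X,S)$. Let $\mathcal D_{\mathrm{train}}$ and $\mathcal D_{\mathrm{val}}$ be a training set of $n$ and a validation set of $m$ samples, all i.i.d. copies of $(X^\sigma,S)$, and let $\mathcal H\subseteq\{f:\mathbb R^d\to[0,1]\}$ be a class of (Borel measurable) functions. Then $$\mathrm{MMSE}(S\vert X^\sigma)\ \ge\ \mathrm{MSE}_{\mathrm{val}}(\hat h_{\mathcal H})-\tilde\epsilon_C-\epsilon_G-\epsilon_C-\epsilon_A,$$ where $$\tilde\epsilon_C:=\mathrm{MSE}_{\mathrm{val}}(\hat h_{\mathcal H})-\mathbb E[(S-\hat h_{\mathcal H}(X^\sigma))^2],\qquad \epsilon_G:=\mathbb E[(S-\hat h_{\mathcal H}(X^\sigma))^2]-\mathrm{MSE}_{\mathrm{train}}(\hat h_{\mathcal H}),$$ $$\epsilon_C := \mathrm{MSE}_{\mathrm{train}}(h^*_{\mathcal H})-\mathrm{MMSE}^{\mathcal H}(S\vert X^\sigma),\qquad \epsilon_A := \mathbb E\big[(\eta^\sigma(X^\sigma)-h^*_{\mathcal H}(X^\sigma))^2\big].$$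
   Context: $\mathrm{MMSE}(S\vert X^\sigma)=\inf_{h}\mathbb E[(S-h(X^\sigma))^2]$, the infimum being over all Borel measurable $h:\mathbb R^d\to\mathbb R$. $\eta^\sigma(x)=\mathbb E[S\vert X^\sigma=x]$. $\mathrm{MMSE}^{\mathcal H}(S\vert X^\sigma)=\min_{h\in\mathcal H}\mathbb E[(S-h(X^\sigma))^2]$, and $h^*_{\mathcal H}\in\mathcal H$ denotes a minimizer (the minimum is assumed attained). For $y\in\{\mathrm{train},\mathrm{val}\}$ and $h\in\mathcal H$, $\mathrm{MSE}_y(h)=\frac{1}{|\mathcal D_y|}\sum_{(x,s)\in\mathcal D_y}(s-h(x))^2$, and $\hat h_{\mathcal H}\in\arg\min_{h\in\mathcal H}\mathrm{MSE}_{\mathrm{train}}(h)$ is an empirical minimizer on the training set (assumed to exist). In $\mathbb E[(S-\hat h_{\mathcal H}(X^\sigma))^2]$ the function $\hat h_{\mathcal H}$ is held fixed and the expectation is over a fresh pair $(X^\sigma,S)$. The inequality holds for every realization of the training and validation sets. *)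

(* Defs.v *)
From HB Require Import structures.
From mathcomp Require Import all_boot all_order all_algebra.
From mathcomp Require Import all_classical all_reals all_analysis.

Set Implicit Arguments.
Unset Strict Implicit.
Unset Printing Implicit Defensive.
Import Order.TTheory GRing.Theory Num.Theory.
Import numFieldNormedType.Exports.

Local Open Scope classical_set_scope.
Local Open Scope ring_scope.

(* R^d is [d.-tuple R]; its measurable sets form the d-fold product of the
   Borel sigma-algebra of R, that is, the Borel sigma-algebra of R^d. *)

Section Probability.
Context {dT dU dV : measure_display} {T : measurableType dT}
  {U : measurableType dU} {V : measurableType dV} {R : realType}.
Variable P : probability T R.

Definition independent (X : T -> U) (Y : T -> V) : Prop :=
  forall (A : set U) (B : set V), measurable A -> measurable B ->
    P (X @^-1` A `&` Y @^-1` B) = (P (X @^-1` A) * P (Y @^-1` B))%E.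

Definition mutually_independent (I : finType) (X : I -> T -> U) : Prop :=
  forall (J : {set I}) (A : I -> set U), (forall i, measurable (A i)) ->
    P (\bigcap_(i in [set` J]) X i @^-1` A i) =
    (\prod_(i in J) P (X i @^-1` A i))%E.

(* [eta] is a version of the regression function y |-> E[S | Y = y]. *)
Definition cond_expectation_given (S : T -> R) (Y : T -> U) (eta : U -> R)
    : Prop :=
  [/\ measurable_fun [set: U] eta,
      P.-integrable [set: T] (fun w => (eta (Y w))%:E) &
      forall A : set U, measurable A ->
        (\int[P]_(w in Y @^-1` A) (eta (Y w))%:E =
         \int[P]_(w in Y @^-1` A) (S w)%:E)%E].

(* E[(S - h(Y))^2]; it may be +oo when h is unbounded. *)
Definition mean_square_error (S : T -> R) (Y : T -> U) (h : U -> R) : \bar R :=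
  'E_P[fun w => (S w - h (Y w)) ^+ 2].

Definition MMSE_in (H : set (U -> R)) (S : T -> R) (Y : T -> U) : \bar R :=
  ereal_inf [set mean_square_error S Y h | h in H].

Definition MMSE (S : T -> R) (Y : T -> U) : \bar R :=
  MMSE_in [set h | measurable_fun [set: U] h] S Y.

End Probability.

Definition argmin {F : Type} {disp : Order.disp_t} {K : porderType disp}
    (H : set F) (J : F -> K) : set F :=
  [set h | H h /\ forall g, H g -> (J h <= J g)%O].

(* A data set is an indexed family of pairs (x, s), so that repeated samples
   are counted with multiplicity. *)
Definition empirical_MSE {R : realType} {U : Type} {n : nat}
    (D : 'I_n -> U * R) (h : U -> R) : R :=
  n%:R^-1 * \sum_(i < n) ((D i).2 - h (D i).1) ^+ 2.

(* N(0, I_d): independent coordinates, each of law N(0, 1). *)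
Definition standard_normal_vector {dT : measure_display}
    {T : measurableType dT} {R : realType} (P : probability T R) {d : nat}
    (Z : T -> d.-tuple R) : Prop :=
  mutually_independent P (fun (i : 'I_d) w => tnth (Z w) i) /\
  forall (i : 'I_d) (A : set R), measurable A ->
    pushforward P (fun w => tnth (Z w) i) A = normal_prob 0 1 A.

Definition add_noise {R : realType} {T : Type} {d : nat} (sigma : R)
    (X Z : T -> d.-tuple R) : T -> d.-tuple R :=
  fun w => [tuple tnth (X w) i + sigma * tnth (Z w) i | i < d].

(* Main.v *)
(** The corrections [epst_C] and [eps_G] telescope, so the right-hand side equals
    [MSE_train hhat - MSE_train hstar + MSE hstar - eps_A], and the first
    difference is at most 0 because [hhat] minimises the training error. What
    remains is [MSE hstar - E (eta - hstar)^2 <= MSE h] for every measurable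
    [h]. As [S] lies in [0, 1], [h] may be truncated to [0, 1]; the inequality
    then follows from the orthogonality of [S - eta(Xs)] to bounded functions
    of [Xs]. *)
Require Import Defs.
From HB Require Import structures.
From mathcomp Require Import all_boot all_order all_algebra.
From mathcomp Require Import all_classical all_reals all_analysis.
From mathcomp Require Import measurable_realfun ring lra.

Set Implicit Arguments.
Unset Strict Implicit.
Unset Printing Implicit Defensive.
Import Order.TTheory GRing.Theory Num.Theory.
Import numFieldNormedType.Exports.

Local Open Scope classical_set_scope.
Local Open Scope ring_scope.


(** * Integrals of bounded functions of [Y] against a function of zero conditional mean *)

Section Orthogonality.
Context {dT dU : measure_display} {T : measurableType dT}
  {U : measurableType dU} {R : realType}.
Variables (mu : {measure set T -> \bar R}) (Y : T -> U) (D : T -> R).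
Hypotheses (mY : measurable_fun [set: T] Y)
  (iD : mu.-integrable [set: T] (EFin \o D)).

Lemma integrable_mul_le1 (g : U -> R) : measurable_fun [set: U] g ->
  (forall y, `|g y| <= 1) ->
  mu.-integrable [set: T] (EFin \o (fun w => D w * g (Y w))).
Proof.
move=> mg g1; have /integrableP[/measurable_EFinP mD _] := iD.
apply: (le_integrable _ _ _ iD) => //.
  apply/measurable_EFinP/measurable_funM => //.
  exact: (measurableT_comp mg mY).
by move=> w _ /=; rewrite lee_fin normrM ler_piMr.
Qed.

(** When [mu] is a probability, this says that the conditional expectation of [D] given [Y]
    vanishes. *)
Hypothesis D0 : forall A, measurable A -> \int[mu]_(w in Y @^-1` A) D w = 0.

(* With [A] the set where [0 <= g], the function [2 g - (2 1_A - 1)] is again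
   bounded by 1, and its integral against [D] is twice that of [g]; iterating,
   the integral of [D g] is bounded by [2^-k] times the integral of [|D|]. *)
Lemma Rintegral_mul_le1_eq0 (g : U -> R) : measurable_fun [set: U] g ->
  (forall y, `|g y| <= 1) -> \int[mu]_w (D w * g (Y w)) = 0.
Proof.
(* The bound is proved for all [f] at once, since the induction step passes from [f] to another
   function [f']. *)
have bound k : forall f : U -> R, measurable_fun [set: U] f ->
    (forall y, `|f y| <= 1) ->
    `|\int[mu]_w (D w * f (Y w))| * 2 ^+ k <= \int[mu]_w `|D w|.
  elim: k => [|k IH] f mf f1.
    rewrite expr0 mulr1.
    apply: le_trans (le_normr_Rintegral _ _) _ => //.
      exact: integrable_mul_le1.
    apply: le_Rintegral => //.
    - have := integrable_abse (integrable_mul_le1 mf f1).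
      by apply: eq_integrable.
    - by have := integrable_abse iD; apply: eq_integrable.
    - by move=> w _; rewrite normrM ler_piMr.
  pose A := [set y | 0 <= f y].
  have mA : measurable A.
    rewrite [A](_ : _ = [set: U] `&` f @^-1` `[0, +oo[%classic); last first.
      by rewrite setTI; apply/seteqP; split => y /=; rewrite in_itv /= andbT.
    exact: mf.
  have mI : measurable_fun [set: U] (\1_A : U -> R) by exact: measurable_indic.
  have I1 y : `|\1_A y : R| <= 1.
    by rewrite indicE; case: (_ \in _); rewrite ?normr1 ?normr0.
  pose f' y := 2 * f y - (2 * \1_A y - 1).
  have mf' : measurable_fun [set: U] f'.
    by apply: measurable_funB; [|apply: measurable_funB => //];
      exact: measurable_funM.
  have f'1 y : `|f' y| <= 1.
    (* On [A], [f' = 2 f - 1] with [f] in [0, 1]; off [A], [f' = 2 f + 1] with [f] in [-1, 0). *)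
    have := f1 y; rewrite /f' indicE !ler_norml => /andP[? ?].
    have -> : (y \in A) = (0 <= f y) by apply/idP/idP => [/set_mem|/mem_set].
    by case: (leP 0 (f y)) => ? /=; apply/andP; split; lra.
  have I0 : \int[mu]_w (D w * \1_A (Y w)) = 0.
    rewrite -(D0 mA) [RHS]Rintegral_mkcond; congr Rintegral; apply/funext => w.
    by rewrite patch_indic.
  have D0T : \int[mu]_w D w = 0 by rewrite -(D0 measurableT) preimage_setT.
  (* Solving for [f] gives [f = f' / 2 + 1_A - 1 / 2]; the last two terms contribute nothing, by
     [D0] at [A] and at the whole space. *)
  have -> : \int[mu]_w (D w * f (Y w)) =
      2^-1 * \int[mu]_w (D w * f' (Y w)).
    have -> : \int[mu]_w (D w * f (Y w)) =
        \int[mu]_w (2^-1 * (D w * f' (Y w)) + (D w * \1_A (Y w) - 2^-1 * D w)).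
      by apply: eq_Rintegral => w _; rewrite /f'; field.
    have i1 := integrable_mul_le1 mf' f'1.
    have i2 := integrable_mul_le1 mI I1.
    have i3 := integrableZl measurableT 2^-1 iD.
    rewrite RintegralD //.
    - by rewrite RintegralB // !RintegralZl // I0 D0T mulr0 subr0 addr0.
    - exact: (integrableZl measurableT 2^-1 i1).
    - exact: (integrableB measurableT i2 i3).
  rewrite normrM gtr0_norm ?invr_gt0 // exprS.
  rewrite mulrACA mulVf ?pnatr_eq0 // mul1r.
  exact: IH.
(* Were the integral nonzero, [bound] would give [2 ^+ k <= c / |integral|] for every [k], which
   fails at the Archimedean bound of the quotient. *)
move=> mg g1; apply/eqP/contraT => g0.
set c := \int[mu]_w `|D w| in bound.
have := bound (Num.Def.archi_bound (c / `|\int[mu]_w (D w * g (Y w))|)) _ mg g1.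
rewrite mulrC -ler_pdivlMr ?normr_gt0 // leNgt.
by rewrite upper_nthrootP.
Qed.

End Orthogonality.

(** * Mean square errors and the regression function *)

Section Regression.
Context {dT dU : measure_display} {T : measurableType dT}
  {U : measurableType dU} {R : realType}.
Variables (P : probability T R) (S : {RV P >-> R}) (Y : T -> U).
Hypotheses (S01 : forall w, 0 <= S w <= 1)
  (mY : measurable_fun [set: T] Y).

Lemma measurable_residual_sq (h : U -> R) : measurable_fun [set: U] h ->
  measurable_fun [set: T] (fun w => (S w - h (Y w)) ^+ 2).
Proof.
move=> mh; apply/measurable_funX/measurable_funB => //.
exact: (measurableT_comp mh mY).
Qed.

Lemma integrable_bounded1 (f : T -> R) : measurable_fun [set: T] f ->
  (forall w, `|f w| <= 1) -> P.-integrable [set: T] (EFin \o f).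
Proof.
move=> mf f1; apply: (@le_integrable _ _ _ _ _ measurableT _ (EFin \o cst 1)).
- exact/measurable_EFinP.
- by move=> w _; rewrite /= lee_fin normr1.
- exact: finite_measure_integrable_cst.
Qed.

Lemma residual_sq_le1 (h : U -> R) w : (forall y, 0 <= h y <= 1) ->
  `|(S w - h (Y w)) ^+ 2| <= 1.
Proof.
move=> /(_ (Y w)) /andP[? ?]; have /andP[? ?] := S01 w.
by rewrite normrX expr_le1 // ler_norml; apply/andP; split; lra.
Qed.

Let iS : P.-integrable [set: T] (EFin \o S).
Proof.
apply: integrable_bounded1 => // w; have /andP[? ?] := S01 w.
by rewrite ger0_norm.
Qed.

Lemma integrable_residual_sq (h : U -> R) : measurable_fun [set: U] h ->
  (forall y, 0 <= h y <= 1) ->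
  P.-integrable [set: T] (EFin \o (fun w => (S w - h (Y w)) ^+ 2)).
Proof.
move=> mh h01; apply: integrable_bounded1; first exact: measurable_residual_sq.
by move=> w; exact: residual_sq_le1.
Qed.

(** Residuals in [-1, 1] make the expectation finite, so that errors of predictors with values in
    [0, 1] can be handled by real arithmetic. *)
Lemma mean_square_error_Rintegral (h : U -> R) : measurable_fun [set: U] h ->
  (forall y, 0 <= h y <= 1) ->
  mean_square_error P S Y h = (\int[P]_w (S w - h (Y w)) ^+ 2)%:E.
Proof.
move=> mh h01; rewrite /mean_square_error unlock /Rintegral fineK //.
exact: integrable_fin_num (integrable_residual_sq mh h01).
Qed.

Definition clamp01 (h : U -> R) (y : U) : R := Num.min 1 (Num.max 0 (h y)).

Lemma measurable_clamp01 (h : U -> R) : measurable_fun [set: U] h ->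
  measurable_fun [set: U] (clamp01 h).
Proof. by move=> mh; apply: measurable_minr => //; exact: measurable_maxr. Qed.

Lemma clamp01_itv (h : U -> R) y : 0 <= clamp01 h y <= 1.
Proof.
by rewrite /clamp01; case: (leP 0 (h y)) => ?;
  case: (leP 1 _) => ?; apply/andP; split; lra.
Qed.

(** Projecting a value onto [0, 1] never moves it away from a point of [0, 1] such as [S w], so the
    squared residual decreases pointwise. *)
Lemma mean_square_error_clamp01 (h : U -> R) : measurable_fun [set: U] h ->
  (mean_square_error P S Y (clamp01 h) <= mean_square_error P S Y h)%E.
Proof.
move=> mh; rewrite /mean_square_error unlock; apply: ge0_le_integral => //.
- by move=> w _; rewrite lee_fin sqr_ge0.
- exact/measurable_EFinP/measurable_residual_sq/measurable_clamp01.
- exact/measurable_EFinP/measurable_residual_sq.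
- move=> w _; rewrite lee_fin /clamp01; have /andP[? ?] := S01 w.
  by case: (leP 0 (h (Y w))) => ?; case: (leP 1 _) => ?; nra.
Qed.

(** This provides the hypothesis [D0] for [D = S - eta(Y)]; integrability of both terms allows the
    integral to be split. *)
Lemma Rintegral_regression_residual (eta : U -> R) (A : set U) :
  cond_expectation_given P S Y eta -> measurable A ->
  \int[P]_(w in Y @^-1` A) (S w - eta (Y w)) = 0.
Proof.
move=> [_ ieta etaE] mA.
have mYA : measurable (Y @^-1` A).
  by rewrite -[X in measurable X]setTI; exact: mY.
rewrite RintegralB //.
- by rewrite /Rintegral (etaE _ mA) subrr.
- exact: integrableS iS.
- exact: integrableS ieta.
Qed.

(* Writing [eta] for the regression function, the difference
   [(S - h)^2 + (eta - k)^2 - (S - k)^2] equals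
   [(eta - h)^2 + 2 (S - eta) (k - h)], whose last term has mean zero. If
   [(eta - k)^2] is not integrable, the left-hand side is [-oo]. *)
Lemma mean_square_error_sub_approx_le (eta k h : U -> R) :
  cond_expectation_given P S Y eta ->
  measurable_fun [set: U] k -> (forall y, 0 <= k y <= 1) ->
  measurable_fun [set: U] h ->
  (mean_square_error P S Y k - 'E_P[(fun w => (eta (Y w) - k (Y w)) ^+ 2)%R]
   <= mean_square_error P S Y h)%E.
Proof.
move=> etaP mk k01 mh0; have [meta ieta _] := etaP.
apply: le_trans (mean_square_error_clamp01 mh0).
have := measurable_clamp01 mh0; have := clamp01_itv h.
move: {h mh0} (clamp01 h) => h h01 mh.
rewrite !mean_square_error_Rintegral //.
have metak : measurable_fun [set: T] (fun w => (eta (Y w) - k (Y w)) ^+ 2).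
  apply/measurable_funX/measurable_funB.
    exact: (measurableT_comp meta mY).
  exact: (measurableT_comp mk mY).
have [->|Afin] := eqVneq ('E_P[(fun w => (eta (Y w) - k (Y w)) ^+ 2)%R])%E +oo%E.
  by rewrite leNye.
have iA : P.-integrable [set: T] (EFin \o (fun w => (eta (Y w) - k (Y w)) ^+ 2)).
  apply/integrableP; split; first exact/measurable_EFinP.
  rewrite ltey; apply: contra Afin => /eqP <-; rewrite unlock; apply/eqP.
  by apply: eq_integral => w _ /=; rewrite ger0_norm // sqr_ge0.
have -> : ('E_P[(fun w => (eta (Y w) - k (Y w)) ^+ 2)%R])%E =
    (\int[P]_w (eta (Y w) - k (Y w)) ^+ 2)%:E.
  by rewrite unlock /Rintegral fineK //; exact: integrable_fin_num iA.
rewrite -EFinB lee_fin lerBlDr.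
have iD : P.-integrable [set: T] (EFin \o (fun w => S w - eta (Y w))).
  exact: (integrableB measurableT iS ieta).
(* The truncation of [h] pays off here: [k - h] is a difference of two values in [0, 1], hence an
   admissible test function for orthogonality. *)
have mkh : measurable_fun [set: U] (fun y => k y - h y) by exact: measurable_funB.
have kh1 y : `|k y - h y| <= 1.
  have /andP[? ?] := k01 y; have /andP[? ?] := h01 y.
  by rewrite ler_norml; apply/andP; split; lra.
have orth := Rintegral_mul_le1_eq0 mY iD
  (fun A mA => Rintegral_regression_residual etaP mA) mkh kh1.
have i2 := integrableZl measurableT 2 (integrable_mul_le1 mY iD mkh kh1).
have ik := integrable_residual_sq mk k01.
have ih := integrable_residual_sq mh h01.
(* Inserting the cross term of mean zero turns the comparison of integrals into a pointwise one. *)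
have -> : \int[P]_w (S w - k (Y w)) ^+ 2 = \int[P]_w ((S w - k (Y w)) ^+ 2 +
    2 * ((S w - eta (Y w)) * (k (Y w) - h (Y w)))).
  rewrite RintegralD // RintegralZl ?orth ?mulr0 ?addr0 //.
  exact: (integrable_mul_le1 mY iD mkh kh1).
rewrite -RintegralD //; apply: le_Rintegral => //.
- exact: (integrableD measurableT ik i2).
- exact: (integrableD measurableT ih iA).
- move=> w _; rewrite -subr_ge0.
  rewrite [leRHS](_ : _ = (eta (Y w) - h (Y w)) ^+ 2) ?sqr_ge0 //; ring.
Qed.

End Regression.

(** * The noisy observation and the final inequality *)

Lemma measurable_add_noise {R : realType} {dT : measure_display}
    {T : measurableType dT} {d : nat} (sigma : R) (X Z : T -> d.-tuple R) :
  measurable_fun [set: T] X -> measurable_fun [set: T] Z ->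
  measurable_fun [set: T] (add_noise sigma X Z).
Proof.
move=> /measurable_fun_tnthP mX /measurable_fun_tnthP mZ.
apply/measurable_fun_tnthP => i.
rewrite [_ \o _](_ : _ = fun w => tnth (X w) i + sigma * tnth (Z w) i).
  by apply: measurable_funD; [exact: mX|apply: measurable_funM => //; exact: mZ].
by apply/funext => w /=; rewrite tnth_mktuple.
Qed.

Theorem theorem2 (R : realType) (d : nat) (hd : (1 <= d)%N)
    (dT : measure_display) (T : measurableType dT) (P : probability T R)
    (X : {RV P >-> d.-tuple R}) (S : {RV P >-> R})
    (hS : forall w, 0 <= S w <= 1)
    (sigma : R) (hsigma : 0 < sigma)
    (Z : {RV P >-> d.-tuple R})
    (hZ : standard_normal_vector P Z)
    (hZXS : independent P Z (fun w => (X w, S w)))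
    (Xs := add_noise sigma X Z : T -> d.-tuple R)
    (n m : nat) (hn : (0 < n)%N) (hm : (0 < m)%N)
    (dT' : measure_display) (T' : measurableType dT') (Q : probability T' R)
    (train : 'I_n -> {RV Q >-> (d.-tuple R * R)%type})
    (val : 'I_m -> {RV Q >-> (d.-tuple R * R)%type})
    (sample := fun k : 'I_n + 'I_m =>
       match k with inl i => train i | inr j => val j end
       : T' -> d.-tuple R * R)
    (hindep : mutually_independent Q sample)
    (hident : forall k (A : set (d.-tuple R * R)), measurable A ->
       pushforward Q (sample k) A = pushforward P (fun w => (Xs w, S w)) A)
    (H : set (d.-tuple R -> R))
    (hHmeas : forall h, H h -> measurable_fun [set: d.-tuple R] h)
    (hH01 : forall h, H h -> forall x, 0 <= h x <= 1)
    (eta : d.-tuple R -> R) (heta : cond_expectation_given P S Xs eta)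
    (hstar : d.-tuple R -> R)
    (hhstar : argmin H (mean_square_error P S Xs) hstar)
    (w : T')
    (MSE_train := empirical_MSE (fun i => train i w)
       : (d.-tuple R -> R) -> R)
    (MSE_val := empirical_MSE (fun j => val j w)
       : (d.-tuple R -> R) -> R)
    (hhat : d.-tuple R -> R) (hhhat : argmin H MSE_train hhat)
    (epst_C := ((MSE_val hhat)%:E - mean_square_error P S Xs hhat)%E
       : \bar R)
    (eps_G := (mean_square_error P S Xs hhat - (MSE_train hhat)%:E)%E
       : \bar R)
    (eps_C := ((MSE_train hstar)%:E - MMSE_in P H S Xs)%E : \bar R)
    (eps_A := ('E_P[(fun w0 => (eta (Xs w0) - hstar (Xs w0)) ^+ 2)%R])%E
       : \bar R) :
  (MMSE P S Xs >= (MSE_val hhat)%:E - epst_C - eps_G - eps_C - eps_A)%E.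

Proof.
have mXs : measurable_fun [set: T] Xs by exact: measurable_add_noise.
have [Hstar star_min] := hhstar; have [Hhat hat_min] := hhhat.
have MMSE_H : MMSE_in P H S Xs = mean_square_error P S Xs hstar.
  apply/eqP; rewrite eq_le; apply/andP; split.
    by apply: ereal_inf_lbound; exists hstar.
  by apply: le_ereal_inf_tmp => _ [h Hh <-]; exact: star_min.
have star_le : (mean_square_error P S Xs hstar - eps_A <= MMSE P S Xs)%E.
  apply: le_ereal_inf_tmp => _ [h mh <-].
  apply: (mean_square_error_sub_approx_le hS mXs heta) => //.
  - exact: hHmeas.
  - exact: hH01.
apply: le_trans star_le.
rewrite /epst_C /eps_G /eps_C MMSE_H.
have := hat_min _ Hstar.
rewrite !(mean_square_error_Rintegral hS mXs); try exact: hHmeas; try exact: hH01.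
(* The extended real [eps_A] occurs on both sides and is removed by monotonicity of subtraction;
   only real numbers remain. *)
move=> train_le; apply: leeB => //; rewrite -!EFinB lee_fin.
lra.
Qed.
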